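(* Let $F$ be the free group on two generators $a,b$. If $R\in F$ is a root of $aba^{-1}b^{-1}$, then $R$ is either a primitive element of $F$ or a conjugate of $aba^{-1}b^{-1}$ in $F$.
   Context: A word $R\in F$ is called a root of $W\in F$ if $W=1$ follows from $R=1$, i.e. if $W$ lies in the normal closure of $R$ in $F$. An element of $F$ is primitive if it belongs to some free basis of $F$.
   Formalization: The conclusion also allows R to be a conjugate of the inverse of aba⁻¹b⁻¹; without this the claim fails, since (aba⁻¹b⁻¹)⁻¹ is a root of aba⁻¹b⁻¹ but is neither primitive nor a conjugate of it. *)

(* Defs.v *)
From mathcomp Require Import all_boot.
From mathcomp Require Import boolp classical_sets.

Set Implicit Arguments.
Unset Strict Implicit.
Unset Printing Implicit Defensive.

Local Open Scope classical_set_scope.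
Local Open Scope group_scope.

(* Universal property. Only the values of [f] on [B] matter, so [f] stands for
   an arbitrary map from [B] to [G]. Mathcomp's [{multiplicative _ -> _}] are
   the group homomorphisms: preservation of 1 and inverses is automatic. *)
Definition free_basis (F : groupType) (B : set F) : Prop :=
  forall (G : groupType) (f : F -> G),
  exists2 h : {multiplicative F -> G},
    (forall x, B x -> h x = f x) &
    forall h' : {multiplicative F -> G},
      (forall x, B x -> h' x = f x) -> h' =1 h.

Definition primitive (F : groupType) (x : F) : Prop :=
  exists2 B : set F, free_basis B & B x.

Definition normal_subgroup (F : groupType) (N : set F) : Prop :=
  [/\ N 1,
      (forall x y, N x -> N y -> N (x * y)),
      (forall x, N x -> N x^-1) &
      (forall x g, N x -> N (x ^ g))].

Definition normal_closure (F : groupType) (A : set F) : set F :=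
  smallest (@normal_subgroup F) A.

Definition is_root (F : groupType) (R W : F) : Prop :=
  normal_closure [set R] W.

Definition conjugate (F : groupType) (x y : F) : Prop :=
  exists g : F, x = y ^ g.

(* Main.v *)
Require Import Defs.
From HB Require Import structures.
From mathcomp Require Import all_boot all_algebra.
From mathcomp Require Import boolp classical_sets.
From mathcomp Require Import zify ring.

(** A relation that implies commutativity of the two generators is treated by
    rewriting it along one of them, following Magnus.

    An elementary change of basis fixes the commutator of the basis, so the
    Euclidean algorithm on exponent sums allows R to have exponent sum zero in b
    ([root_of_commutator_pair]). Then R is conjugate to a word v in the conjugates
    a_i of a by the powers of b. If v lives on a single level i, then R is conjugate
    to a power of a, and the exponent must be 1 or -1 because otherwise some group
    satisfies R = 1 without being commutative ([noncommuting_torsion]): R is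
    primitive. Otherwise let mu < M be the extreme levels of v. The one-relator
    group of v embeds in a group in which the shift of levels is a conjugation
    ([stable_letter_model]); as the commutator is conjugate to the quotient of
    a_(mu+1) by a_mu, this quotient is a consequence of v. By the Freiheitssatz
    ([freiheitssatz]) a nontrivial consequence of v cannot avoid a_M, so M = mu + 1
    and v is a relator in the free group on a_mu and a_(mu+1), of which the quotient
    is a basis element. The same rewriting argument shows that a relator implying a
    basis element is conjugate to it or to its inverse ([root_of_generator]), and so
    R is conjugate to the commutator or to its inverse.

    The Freiheitssatz is proved by induction on the length of the relator. Its
    only constructions are permutation groups: a group acting on copies of itself
    together with a permutation that conjugates one subgroup to another
    ([partial_isomorphism_conjugation]) or that is a root of a given element
    ([adjoin_root]). Since words are compared through their values in all groups,
    neither reduced words nor normal forms occur. *)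

Set Implicit Arguments.
Unset Strict Implicit.
Unset Printing Implicit Defensive.

Local Open Scope classical_set_scope.
Local Open Scope group_scope.

(** * Permutation groups and the integers *)

Record bij (T : Type) := Bij {
  bij_fun :> T -> T;
  bij_inv : T -> T;
  bij_funK : cancel bij_fun bij_inv;
  bij_invK : cancel bij_inv bij_fun }.

Lemma bijP (T : Type) (f g : bij T) : f =1 g -> f = g.
Proof.
case: f g => [f f' fK f'K] [g g' gK g'K] /= /funext fg.
have fg' : f' = g' by apply: funext => x; rewrite -[x in LHS]g'K -fg fK.
by subst; congr Bij; apply: Prop_irrelevance.
Qed.

HB.instance Definition _ (T : Type) := gen_eqMixin (bij T).
HB.instance Definition _ (T : Type) := gen_choiceMixin (bij T).

Definition bij_one (T : Type) : bij T :=
  @Bij T id id (fun=> erefl) (fun=> erefl).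
Definition bij_mul (T : Type) (f g : bij T) : bij T :=
  @Bij T (f \o g) (bij_inv g \o bij_inv f)
    (can_comp (@bij_funK T f) (@bij_funK T g))
    (can_comp (@bij_invK T g) (@bij_invK T f)).
Definition bij_op (T : Type) (f : bij T) : bij T :=
  Bij (@bij_invK T f) (@bij_funK T f).

Lemma bij_mulA (T : Type) : associative (@bij_mul T).
Proof. by move=> f g h; apply: bijP. Qed.
Lemma bij_mul1 (T : Type) : left_id (bij_one T) (@bij_mul T).
Proof. by move=> f; apply: bijP. Qed.
Lemma bij_muln1 (T : Type) : right_id (bij_one T) (@bij_mul T).
Proof. by move=> f; apply: bijP. Qed.
Lemma bij_mulV (T : Type) : left_inverse (bij_one T) (@bij_op T) (@bij_mul T).
Proof. by move=> f; apply: bijP => x /=; rewrite bij_funK. Qed.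
Lemma bij_mulVr (T : Type) : right_inverse (bij_one T) (@bij_op T) (@bij_mul T).
Proof. by move=> f; apply: bijP => x /=; rewrite bij_invK. Qed.

HB.instance Definition _ (T : Type) := isGroup.Build (bij T)
  (@bij_mulA T) (@bij_mul1 T) (@bij_muln1 T) (@bij_mulV T) (@bij_mulVr T).

Lemma bijM (T : Type) (f g : bij T) x : (f * g) x = f (g x).
Proof. by []. Qed.

(** The integers as a multiplicative group; exponent sums are values in it. *)
Definition intg : Type := int.
HB.instance Definition _ := Choice.on intg.
HB.instance Definition _ := isGroup.Build intg
  (@GRing.addrA int) (@GRing.add0r int) (@GRing.addr0 int)
  (@GRing.addNr int) (@GRing.addrN int).

Lemma intgM (x y : intg) : x * y = (x + y)%R :> intg. Proof. by []. Qed.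
Lemma intgV (x : intg) : x^-1 = (- x)%R :> intg. Proof. by []. Qed.
Lemma intg1 : (1 : intg) = 0%R :> intg. Proof. by []. Qed.

(** * Words and their values in groups *)

(** A pair (x, b) stands for x when b is false and for the inverse of x when b is
    true. Words are not required to be reduced: two words denote the same element
    of the free group exactly when they have the same value in every group, and
    all notions below are phrased through such values. *)
Definition word (X : choiceType) := seq (X * bool).
HB.instance Definition _ (X : choiceType) := Choice.on (word X).

Definition ev_letter (X : choiceType) (G : groupType) (f : X -> G)
  (l : X * bool) : G := if l.2 then (f l.1)^-1 else f l.1.
Definition ev (X : choiceType) (G : groupType) (f : X -> G) (w : word X) : G :=
  \prod_(l <- w) ev_letter f l.

Definition letters (X : choiceType) (w : word X) : seq X := unzip1 w.
Definition winv (X : choiceType) (w : word X) : word X :=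
  rev [seq (l.1, ~~ l.2) | l <- w].

Lemma ev_nil (X : choiceType) (G : groupType) (f : X -> G) : ev f [::] = 1.
Proof. by rewrite /ev big_nil. Qed.

Lemma ev_cons (X : choiceType) (G : groupType) (f : X -> G) l w :
  ev f (l :: w) = ev_letter f l * ev f w.
Proof. by rewrite /ev big_cons. Qed.

Lemma ev_cat (X : choiceType) (G : groupType) (f : X -> G) u v :
  ev f (u ++ v) = ev f u * ev f v.
Proof. by rewrite /ev big_cat. Qed.

Lemma ev1 (X : choiceType) (G : groupType) (f : X -> G) x b :
  ev f [:: (x, b)] = if b then (f x)^-1 else f x.
Proof. by rewrite ev_cons ev_nil mulg1. Qed.

Lemma ev_inv (X : choiceType) (G : groupType) (f : X -> G) w :
  ev f (winv w) = (ev f w)^-1.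
Proof.
elim: w => [|[x b] w IH]; first by rewrite ev_nil invg1.
rewrite /winv /= rev_cons -cats1 ev_cat IH ev1 ev_cons invgM.
by case: b; rewrite /ev_letter /= ?invgK.
Qed.

Lemma ev_eq_in (X : choiceType) (G : groupType) (f g : X -> G) (w : word X) :
  {in letters w, f =1 g} -> ev f w = ev g w.
Proof.
move=> fg; apply: eq_big_seq => -[x b] xw; rewrite /ev_letter /=.
by rewrite fg //; apply/mapP; exists (x, b).
Qed.

Lemma morph1 (G H : groupType) (h : G -> H) : {morph h : x y / x * y} -> h 1 = 1.
Proof. by move=> hM; apply: (mulgI (h 1)); rewrite -hM !mulg1. Qed.

Lemma morphV (G H : groupType) (h : G -> H) :
  {morph h : x y / x * y} -> {morph h : x / x^-1}.
Proof. by move=> hM x; apply: (mulgI (h x)); rewrite -hM !mulgV morph1. Qed.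

Lemma ev_hom (X : choiceType) (G H : groupType) (h : G -> H) (f : X -> G) w :
  {morph h : x y / x * y} -> h (ev f w) = ev (h \o f) w.
Proof.
move=> hM; elim: w => [|[x b] w IH]; first by rewrite !ev_nil morph1.
by rewrite !ev_cons hM IH; case: b; rewrite /ev_letter /= ?morphV.
Qed.

Lemma ev_conjg (X : choiceType) (G : groupType) (f : X -> G) (t : G) w :
  ev (fun x => f x ^ t) w = ev f w ^ t.
Proof.
elim: w => [|[x b] w IH]; first by rewrite !ev_nil conj1g.
by rewrite !ev_cons conjMg IH; case: b; rewrite /ev_letter /= ?conjVg.
Qed.

Lemma ev_one (X : choiceType) (G : groupType) (f : X -> G) (w : word X) :
  (forall y, y \in letters w -> f y = 1) -> ev f w = 1.
Proof.
move=> f1; rewrite (@ev_eq_in _ _ _ (fun=> 1)) //.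
elim: w {f1} => [|[y b] w IH]; first by rewrite ev_nil.
by rewrite ev_cons IH /ev_letter; case: b; rewrite /= ?invg1 mulg1.
Qed.

Definition relabel (X Y : choiceType) (s : X -> Y) (u : word X) : word Y :=
  [seq (s l.1, l.2) | l <- u].

Lemma ev_relabel (X Y : choiceType) (G : groupType) (s : X -> Y) (f : Y -> G) u :
  ev f (relabel s u) = ev (f \o s) u.
Proof. by rewrite /ev big_map. Qed.

Definition subst (X Y : choiceType) (s : X -> word Y) (w : word X) : word Y :=
  flatten [seq if l.2 then winv (s l.1) else s l.1 | l <- w].

Lemma ev_subst (X Y : choiceType) (G : groupType) (s : X -> word Y)
  (f : Y -> G) w : ev f (subst s w) = ev (fun x => ev f (s x)) w.
Proof.
elim: w => [|[x b] w IH]; first by rewrite !ev_nil.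
by rewrite /subst /= ev_cat IH ev_cons; case: b; rewrite /= ?ev_inv.
Qed.

(** Equivalently, u lies in the normal closure of w in the free group on X. *)
Definition entails (X : choiceType) (w u : word X) : Prop :=
  forall (G : groupType) (f : X -> G), ev f w = 1 -> ev f u = 1.

Definition trivial_word (X : choiceType) (u : word X) : Prop :=
  forall (G : groupType) (f : X -> G), ev f u = 1.

(** Taking for G the free group on X shows that this is conjugacy of the elements
    that v and w denote there. *)
Definition conj_words (X : choiceType) (v w : word X) : Prop :=
  forall (G : groupType) (f : X -> G), exists g : G, ev f v = ev f w ^ g.

(** * One-relator groups *)

(** Equality in the group with generators X and the single relator w. *)
Definition same_in (X : choiceType) (w : word X) (u v : word X) : bool :=
  `[< entails w (u ++ winv v) >].

Lemma same_inP (X : choiceType) (w u v : word X) :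
  reflect (forall (G : groupType) (f : X -> G), ev f w = 1 -> ev f u = ev f v)
    (same_in w u v).
Proof.
apply: (iffP (asboolP _)) => uv G f wf.
  by have := uv G f wf; rewrite ev_cat ev_inv => /divg1_eq.
by rewrite ev_cat ev_inv (uv G f wf) mulgV.
Qed.

Lemma same_in_equiv (X : choiceType) (w : word X) :
  equiv_class_of (same_in w).
Proof.
split=> [u|u v|v u z].
- exact/same_inP.
- by apply/same_inP/same_inP => uv G f wf; rewrite uv.
- move=> /same_inP uv /same_inP vz; apply/same_inP => G f wf.
  by rewrite uv // vz.
Qed.
Canonical same_in_equiv_rel (X : choiceType) (w : word X) :=
  EquivRelPack (same_in_equiv w).

Local Open Scope quotient_scope.

(** The one-relator group of w; it is the free group on X when w is empty. *)
Definition pres (X : choiceType) (w : word X) : Type :=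
  {eq_quot same_in_equiv_rel w}.
HB.instance Definition _ (X : choiceType) (w : word X) := Choice.on (pres w).

Definition pres_cls (X : choiceType) (w u : word X) : pres w :=
  \pi_{eq_quot same_in_equiv_rel w} u.
Definition pres_mul (X : choiceType) (w : word X) (x y : pres w) : pres w :=
  pres_cls w (repr x ++ repr y).
Definition pres_inv (X : choiceType) (w : word X) (x : pres w) : pres w :=
  pres_cls w (winv (repr x)).

Lemma pres_clsP (X : choiceType) (w u v : word X) :
  pres_cls w u = pres_cls w v <->
  forall (G : groupType) (f : X -> G), ev f w = 1 -> ev f u = ev f v.
Proof.
rewrite /pres_cls; split=> [/eqmodP /same_inP //|uv].
by apply/eqmodP/same_inP.
Qed.

Lemma repr_clsP (X : choiceType) (w u : word X) (G : groupType) (f : X -> G) :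
  ev f w = 1 -> ev f (repr (pres_cls w u)) = ev f u.
Proof. by apply: (pres_clsP w _ _).1; rewrite [LHS]reprK. Qed.

Lemma pres_mulE (X : choiceType) (w u v : word X) :
  pres_mul (pres_cls w u) (pres_cls w v) = pres_cls w (u ++ v).
Proof. by apply/pres_clsP => G f wf; rewrite !ev_cat !repr_clsP. Qed.

Lemma pres_invE (X : choiceType) (w u : word X) :
  pres_inv (pres_cls w u) = pres_cls w (winv u).
Proof. by apply/pres_clsP => G f wf; rewrite !ev_inv repr_clsP. Qed.

Lemma pres_ind (X : choiceType) (w : word X) (P : pres w -> Prop) :
  (forall u, P (pres_cls w u)) -> forall x, P x.
Proof. by move=> Pc x; rewrite -[x]reprK; apply: Pc. Qed.

Lemma pres_mulA (X : choiceType) (w : word X) : associative (@pres_mul X w).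
Proof.
elim/(@pres_ind X w)=> u; elim/(@pres_ind X w)=> v; elim/(@pres_ind X w)=> z.
by rewrite !pres_mulE catA.
Qed.
Lemma pres_mul1 (X : choiceType) (w : word X) :
  left_id (pres_cls w [::]) (@pres_mul X w).
Proof. by elim/(@pres_ind X w)=> u; rewrite pres_mulE. Qed.
Lemma pres_muln1 (X : choiceType) (w : word X) :
  right_id (pres_cls w [::]) (@pres_mul X w).
Proof. by elim/(@pres_ind X w)=> u; rewrite pres_mulE cats0. Qed.
Lemma pres_mulV (X : choiceType) (w : word X) :
  left_inverse (pres_cls w [::]) (@pres_inv X w) (@pres_mul X w).
Proof.
elim/(@pres_ind X w)=> u; rewrite pres_invE pres_mulE.
by apply/pres_clsP => G f _; rewrite ev_cat ev_inv mulVg ev_nil.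
Qed.
Lemma pres_mulVr (X : choiceType) (w : word X) :
  right_inverse (pres_cls w [::]) (@pres_inv X w) (@pres_mul X w).
Proof.
elim/(@pres_ind X w)=> u; rewrite pres_invE pres_mulE.
by apply/pres_clsP => G f _; rewrite ev_cat ev_inv mulgV ev_nil.
Qed.

HB.instance Definition _ (X : choiceType) (w : word X) := isGroup.Build (pres w)
  (@pres_mulA X w) (@pres_mul1 X w) (@pres_muln1 X w)
  (@pres_mulV X w) (@pres_mulVr X w).

Definition pres_gen (X : choiceType) (w : word X) (x : X) : pres w :=
  pres_cls w [:: (x, false)].

Lemma ev_pres (X : choiceType) (w u : word X) :
  ev (pres_gen w) u = pres_cls w u.
Proof.
have M v z : pres_cls w (v ++ z) = pres_cls w v * pres_cls w z.
  by rewrite -[LHS]pres_mulE.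
elim: u => [|[x b] u IH]; first by rewrite ev_nil.
rewrite ev_cons IH -cat1s M; congr (_ * _).
by case: b => //; rewrite /ev_letter /= -[LHS]/(pres_inv _) pres_invE.
Qed.

(** Hence a single group tests all consequences of w at once, which is what the
    extension arguments below start from. *)
Lemma ev_pres1 (X : choiceType) (w u : word X) :
  ev (pres_gen w) u = 1 <-> entails w u.
Proof.
rewrite ev_pres -[1]/(pres_cls w [::]) pres_clsP.
by split=> h G f wf; rewrite (h G f wf) ?ev_nil.
Qed.

(** * Conjugating isomorphic subgroups *)

(** The representative is chosen from the coset as a set, so it depends on the
    coset only. *)
Lemma coset_representatives (H : groupType) (A : H -> Prop) :
  A 1 -> (forall x y, A x -> A y -> A (x * y)) -> (forall x, A x -> A x^-1) ->
  exists r : H -> H, (forall h, A (h * (r h)^-1)) /\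
    (forall a h, A a -> r (a * h) = r h).
Proof.
move=> A1 AM AV; exists (fun h => xget 1 [set r | A (h * r^-1)]%classic).
split=> [h|a h Aa].
  have : exists r, [set r | A (h * r^-1)]%classic r by exists h; rewrite /= mulgV.
  by move/(xgetPex 1).
congr (xget 1 _); apply/predeqP => r /=; rewrite -mulgA; split=> [Ahr|]; last exact: AM.
by rewrite -[h * _](mulKg a); apply: AM => //; apply: AV.
Qed.

Definition fixed_points (H : groupType) (r : H -> H) := {x : H | r x == x}.

(** Splits h as a * r h with a in a subgroup and r h its coset representative, and
    replaces a by phi a. The representative r h is pushed on the first stream, and a
    representative for the other subgroup is popped from the second one: the two
    streams absorb any difference between the indices of the two subgroups. *)
Definition exchange (H : groupType) (r r' phi : H -> H)
  (rK : forall h, r (r h) == r h)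
  (x : H * ((nat -> fixed_points r) * (nat -> fixed_points r'))) :
  H * ((nat -> fixed_points r') * (nat -> fixed_points r)) :=
  let: (h, (s, s')) := x in
  (phi (h * (r h)^-1) * val (s' 0),
    (fun i => s' i.+1,
     fun i => if i is j.+1 then s j else exist _ (r h) (rK h))).

Lemma exchangeK (H : groupType) (A B : H -> Prop) (r r' phi psi : H -> H) rK r'K :
  (forall h, A (h * (r h)^-1)) -> (forall b h, B b -> r' (b * h) = r' h) ->
  (forall a, A a -> B (phi a)) -> (forall a, A a -> psi (phi a) = a) ->
  cancel (@exchange H r r' phi rK) (@exchange H r' r psi r'K).
Proof.
move=> Ar Br AB phiK [h [s s']] /=.
have E : r' (phi (h / r h) * val (s' 0)) = val (s' 0).
  by rewrite Br ?(eqP (valP (s' 0))) //; exact: AB.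
congr (_, (_, _)); first by rewrite E mulgK phiK // mulgVK.
by apply: funext => -[|i] //; apply: val_inj.
Qed.

Lemma left_mult_cancel (H : groupType) (K : Type) (g g' : H) : g' * g = 1 ->
  cancel (fun x : H * K => (g * x.1, x.2)) (fun x => (g' * x.1, x.2)).
Proof. by move=> gg' [h k] /=; rewrite mulgA gg' mul1g. Qed.

Definition left_mult (H : groupType) (K : Type) (g : H) : bij (H * K) :=
  Bij (left_mult_cancel (mulVg g)) (left_mult_cancel (mulgV g)).

Lemma left_multM (H : groupType) (K : Type) :
  {morph @left_mult H K : x y / x * y}.
Proof. by move=> x y; apply: bijP => -[h k]; rewrite bijM /= mulgA. Qed.

Lemma left_mult_inj (H : groupType) (K : Type) (k : K) :
  injective (@left_mult H K).
Proof.
move=> x y /(congr1 (fun f : bij (H * K) => (f (1, k)).1)).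
by rewrite /= !mulg1.
Qed.

(** The Higman, Neumann and Neumann embedding, obtained without normal forms. The
    relation D is the graph of an isomorphism between two subgroups A and B of H.
    Left multiplication makes H act on H * K, where K consists of pairs of streams
    of coset representatives of A and of B; both subgroups act freely there, and
    the streams provide a bijection between their orbits. The resulting permutation
    t intertwines the action of A with the action of B. *)
Lemma partial_isomorphism_conjugation (H : groupType) (D : H -> H -> Prop) :
  D 1 1 ->
  (forall x y x' y', D x y -> D x' y' -> D (x * x') (y * y')) ->
  (forall x y, D x y -> D x^-1 y^-1) ->
  (forall x y, D x y -> x = 1 <-> y = 1) ->
  exists (G : groupType) (i : H -> G) (t : G),
    [/\ {morph i : x y / x * y}, injective i &
        forall x y, D x y -> i y = i x ^ t].
Proof.
move=> D1 DM DV D_inj.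
pose A x := exists y, D x y; pose B y := exists x, D x y.
pose phi x := xget 1 (D x); pose psi y := xget 1 (D^~ y).
have phiP x y : D x y -> phi x = y.
  move=> Dxy; have /(xgetPex 1) : exists y, D x y by exists y.
  rewrite -/(phi x) => Dx; apply: divg1_eq; apply: (D_inj 1 _ _).1 => //.
  by rewrite -(mulgV x); apply/DM/DV.
have psiP x y : D x y -> psi y = x.
  move=> Dxy; have /(xgetPex 1) : exists x, D x y by exists x.
  rewrite -/(psi y) => Dy; apply: divg1_eq; apply: (D_inj _ 1 _).2 => //.
  by rewrite -(mulgV y); apply/DM/DV.
have [|||r [Ar rA]] := @coset_representatives H A.
- by exists 1.
- by move=> x y [x' ?] [y' ?]; exists (x' * y'); apply: DM.
- by move=> x [x' ?]; exists x'^-1; apply: DV.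
have [|||r' [Br rB]] := @coset_representatives H B.
- by exists 1.
- by move=> x y [x' ?] [y' ?]; exists (x' * y'); apply: DM.
- by move=> x [x' ?]; exists x'^-1; apply: DV.
have rK h : r (r h) == r h by rewrite -(rA (h / r h)) // mulgVK.
have r'K h : r' (r' h) == r' h by rewrite -(rB (h / r' h)) // mulgVK.
have AB a : A a -> B (phi a) by case=> y Day; rewrite (phiP _ _ Day); exists a.
have BA b : B b -> A (psi b) by case=> x Dxb; rewrite (psiP _ _ Dxb); exists b.
have phiK a : A a -> psi (phi a) = a.
  by case=> y Day; rewrite (phiP _ _ Day) (psiP _ _ Day).
have psiK b : B b -> phi (psi b) = b.
  by case=> x Dxb; rewrite (psiP _ _ Dxb) (phiP _ _ Dxb).
pose K := ((nat -> fixed_points r) * (nat -> fixed_points r'))%type.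
pose sw T1 T2 (x : H * (T1 * T2)) := (x.1, (x.2.2, x.2.1)).
have swK T1 T2 : cancel (@sw T1 T2) (@sw T2 T1) by case=> h [].
pose t : bij (H * K) := Bij
  (can_comp (swK _ _) (exchangeK rK r'K Ar rB AB phiK))
  (can_comp (exchangeK r'K rK Br rA BA psiK) (swK _ _)).
exists (bij (H * K)), (@left_mult H K), t^-1; split.
- exact: left_multM.
- apply: (@left_mult_inj H K).
  by split=> _; [exists (r 1)|exists (r' 1)].
move=> x y Dxy; have Ax : A x by exists y.
rewrite /conjg invgK mulgA; apply: (mulIg t); rewrite mulgVK.
apply: bijP => -[h [s s']]; rewrite !bijM /= /sw /=.
have -> : phi (x * h / r (x * h)) = y * phi (h / r h).
  have [z Dz] := Ar h; rewrite rA // -mulgA (phiP _ _ Dz); apply: phiP.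
  exact: DM.
rewrite mulgA; congr (_, (_, _)); apply: funext => -[|i] //.
by apply: val_inj; rewrite /= rA.
Qed.

(** * Adjoining roots *)

(** Moves from sheet i to sheet i + 1 of n + 1 copies of G, and multiplies by b on
    closing the cycle, so that n + 1 steps amount to multiplication by b. *)
Definition cyclic_shift_fun (G : groupType) (b : G) (n : nat)
  (x : G * 'I_n.+1) : G * 'I_n.+1 :=
  (if x.2 == ord_max then b * x.1 else x.1, ordS x.2).

Definition cyclic_shift_inv (G : groupType) (b : G) (n : nat)
  (x : G * 'I_n.+1) : G * 'I_n.+1 :=
  (if x.2 == ord0 then b^-1 * x.1 else x.1, ord_pred x.2).

Lemma ordS_eq0 n (i : 'I_n.+1) : (ordS i == ord0) = (i == ord_max).
Proof.
rewrite -!val_eqE /=; have := ltn_ord i; rewrite ltnS leq_eqVlt.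
case/orP=> [/eqP->|lt_i]; first by rewrite modnn !eqxx.
by rewrite modn_small // (ltn_eqF lt_i).
Qed.

Lemma cyclic_shift_funK (G : groupType) (b : G) n :
  cancel (@cyclic_shift_fun G b n) (@cyclic_shift_inv G b n).
Proof.
case=> x i; rewrite /cyclic_shift_inv /= ordS_eq0 ordSK.
by case: eqP => _ //; rewrite mulKg.
Qed.

Lemma cyclic_shift_invK (G : groupType) (b : G) n :
  cancel (@cyclic_shift_inv G b n) (@cyclic_shift_fun G b n).
Proof.
case=> x i; rewrite /cyclic_shift_fun /= -ordS_eq0 ord_predK.
by case: eqP => _ //; rewrite mulVKg.
Qed.

Definition cyclic_shift (G : groupType) (b : G) n : bij (G * 'I_n.+1) :=
  Bij (@cyclic_shift_funK G b n) (@cyclic_shift_invK G b n).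

Lemma cyclic_shiftX (G : groupType) (b : G) n :
  cyclic_shift b n ^+ n.+1 = left_mult 'I_n.+1 b.
Proof.
have step k x (i : 'I_n.+1) : i + k < n.+1 ->
    (cyclic_shift b n ^+ k) (x, i) = (x, inord (i + k)).
  elim: k => [|k IH] ik; first by rewrite addn0 inord_val.
  rewrite expgS bijM IH /=; last by lia.
  rewrite /cyclic_shift_fun /= -val_eqE /= inordK; last by lia.
  rewrite ltn_eqF; last by lia.
  congr pair; apply: val_inj; rewrite /= !inordK; try lia.
  by rewrite modn_small; lia.
apply: bijP => -[x i].
(* From sheet i: n - i steps to the last sheet, one step closing the cycle, and i
   steps back to sheet i. *)
have En : n.+1 = i + (1 + (n - i)) by have := ltn_ord i; lia.
rewrite [X in _ ^+ X]En !expgnDr !bijM (step (n - i)); last by have := ltn_ord i; lia.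
have -> : inord (i + (n - i)) = ord_max :> 'I_n.+1.
  by apply: val_inj; rewrite /= inordK; have := ltn_ord i; lia.
have -> : (cyclic_shift b n ^+ 1) (x, ord_max) = (b * x, ord0).
  rewrite /= /cyclic_shift_fun /= eqxx; congr pair.
  by apply: val_inj; rewrite /= modnn.
by rewrite step ?add0n //= inord_val.
Qed.

Lemma adjoin_root (G : groupType) (b : G) n : 0 < n ->
  exists (G' : groupType) (i : G -> G') (c : G'),
    [/\ {morph i : x y / x * y}, injective i & c ^+ n = i b].
Proof.
case: n => // n _; exists (bij (G * 'I_n.+1)).
exists (@left_mult G 'I_n.+1), (cyclic_shift b n); split.
- exact: left_multM.
- exact: (@left_mult_inj _ _ ord0).
- exact: cyclic_shiftX.
Qed.

(** For n > 1, a permutes n copies of the integers cyclically while b translates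
    only one of them. For n = 0 the equation is void, and the pair for n = 2 serves. *)
Lemma noncommuting_torsion (n : nat) : (n != 1)%N ->
  exists (G : groupType) (a b : G), a ^+ n = 1 /\ a * b <> b * a.
Proof.
move=> n1; wlog n2 : n n1 / (1 < n)%N => [hyp|].
  case: (ltnP 1%N n) => [/hyp|]; first exact.
  case: n n1 => [|[]] // _ _; have [//|//|G [a [b [_ ab]]]] := hyp 2.
  by exists G, a, b.
case: n n2 {n1} => [|[|n]] // _; pose T := (intg * 'I_n.+2)%type.
pose shift (e : intg) (x : T) : T := if x.2 == ord0 then (e * x.1, x.2) else x.
have shiftK e e' : e' * e = 1 -> cancel (shift e) (shift e').
  move=> ee' [x i]; rewrite /shift /=; case: (i =P ord0) => /= i0.
    by rewrite i0 eqxx mulgA ee' mul1g.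
  by case: eqP.
pose one : intg := 1%R.
pose b : bij T := Bij (shiftK one one^-1 (mulVg _)) (shiftK one^-1 one (mulgV _)).
exists (bij T), (cyclic_shift (1 : intg) n.+1), b; split.
  by rewrite cyclic_shiftX (morph1 (@left_multM _ _)).
move/(congr1 (fun f : bij T => (f (1, ord0)).1)).
by rewrite !bijM /= /shift /cyclic_shift_fun /=.
Qed.

(** * Shortest words in a conjugacy class *)

Lemma conj_words_sym (X : choiceType) (v w : word X) :
  conj_words v w -> conj_words w v.
Proof. by move=> vw G f; have [g ->] := vw G f; exists g^-1; rewrite conjgK. Qed.

Lemma conj_words_trans (X : choiceType) (v w z : word X) :
  conj_words v w -> conj_words w z -> conj_words v z.
Proof.
move=> vw wz G f; have [g ->] := vw G f; have [h ->] := wz G f.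
by exists (h * g); rewrite conjgM.
Qed.

Lemma conj_words_refl (X : choiceType) (w : word X) : conj_words w w.
Proof. by move=> G f; exists 1; rewrite conjg1. Qed.

Lemma conj_words_ev1 (X : choiceType) (v w : word X) (G : groupType) (f : X -> G) :
  conj_words v w -> ev f v = 1 -> ev f w = 1.
Proof. by move=> vw; have [g ->] := vw G f; move/eqP; rewrite conjg_eq1 => /eqP. Qed.

(** Minimal words replace cyclically reduced words: the only property needed is
    that no letter of such a word can be avoided up to conjugacy. *)
Definition minimal (X : choiceType) (w : word X) : Prop :=
  forall v, conj_words v w -> size w <= size v.

Lemma minimal_conjugate (X : choiceType) (w : word X) :
  exists v, [/\ conj_words v w, minimal v & size v <= size w].
Proof.
have [n] := ubnP (size w); elim: n w => // n IH w wn.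
have [min_w|] := pselect (minimal w).
  by exists w; split=> //; apply: conj_words_refl.
move=> /existsNP[v /not_implyP[vw /negP]]; rewrite -ltnNge => lt_vw.
have [|z [zv zmin le_zv]] := IH v; first by apply: leq_trans lt_vw _.
exists z; split=> //; first exact: conj_words_trans vw.
exact: leq_trans le_zv (ltnW lt_vw).
Qed.

Lemma ev_delete (X : choiceType) (G : groupType) (f : X -> G) x w :
  ev f [seq l <- w | l.1 != x] = ev (fun y => if y == x then 1 else f y) w.
Proof.
elim: w => [|[y b] w IH] /=; first by rewrite !ev_nil.
rewrite ev_cons -IH /ev_letter /=.
case: eqP => _ /=; last by rewrite ev_cons.
by case: b; rewrite ?invg1 mul1g.
Qed.

Lemma ev_avoid (X : choiceType) (G : groupType) (f : X -> G) x c w :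
  x \notin letters w -> ev (fun y => if y == x then c else f y) w = ev f w.
Proof. by move=> xw; apply: ev_eq_in => y yw; case: eqP xw => // <-; rewrite yw. Qed.

(** If x occurred in v but not in w, then sending x to 1 would not change w, so that
    deleting x from v would give a shorter conjugate of w. *)
Lemma minimal_letters (X : choiceType) (v w : word X) :
  minimal v -> conj_words w v -> {subset letters v <= letters w}.
Proof.
move=> min_v wv x xv; apply/negPn/negP => xw.
have : size v <= size [seq l <- v | l.1 != x].
  apply: min_v => G f; rewrite ev_delete.
  have [g] := wv G (fun y => if y == x then 1 else f y).
  rewrite ev_avoid // => Eg; have [h Eh] := wv G f.
  by exists (h * g^-1); rewrite conjgM -Eh Eg conjgK.
rewrite size_filter leqNgt => /negP; apply.
rewrite -(count_predC (fun l : X * bool => l.1 != x) v) -addn1 leq_add2l.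
rewrite -has_count; have /mapP[l lv El] := xv.
by apply/hasP; exists l; rewrite //= negbK El.
Qed.

(** * Rewriting along a stable letter *)

(** The exponent sum of x in w, as the value of w in the integers. *)
Definition wexp (X : choiceType) (x : X) (w : word X) : intg :=
  ev (fun y => Posz (y == x) : intg) w.

(** The letter t lowers the level by one and its inverse raises it. Levels are
    natural numbers; a start level of at least the size of the word makes the
    truncated predecessor harmless. *)
Fixpoint final_level (X : choiceType) (t : X) (n : nat) (w : word X) : nat :=
  if w is (x, b) :: w' then
    if x == t then final_level t (if b then n.+1 else n.-1) w' else final_level t n w'
  else n.

(** When the exponent sum of t is zero, this writes the conjugate of w by the n-th
    power of t as a word in the conjugates (x, i) of the letters x <> t by the i-th
    power of t. *)
Fixpoint rewrite_levels (X : choiceType) (t : X) (n : nat) (w : word X) :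
  word (X * nat)%type :=
  if w is (x, b) :: w' then
    if x == t then rewrite_levels t (if b then n.+1 else n.-1) w'
    else ((x, n), b) :: rewrite_levels t n w'
  else [::].

Definition level_conjugate (X : choiceType) (G : groupType) (f : X -> G) (t : X)
  (z : X * nat) : G := f z.1 ^ (f t ^+ z.2).

Lemma ev_rewrite_levels (X : choiceType) (G : groupType) (f : X -> G) t n w :
  size w <= n ->
  (f t ^- n) * ev f w =
  ev (level_conjugate f t) (rewrite_levels t n w) * f t ^- (final_level t n w).
Proof.
elim: w n => [|[x b] w IH] n /= wn; first by rewrite !ev_nil mul1g mulg1.
rewrite ev_cons /ev_letter /=; case: eqP => [->|_]; last first.
  rewrite ev_cons -mulgA -IH; last by lia.
  by rewrite /ev_letter /level_conjugate /=; case: b; rewrite -?conjVg /conjg -!mulgA mulVKg.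
rewrite -IH; last by case: b; lia.
case: b; first by rewrite expgS invgM mulgA.
by case: n wn => // n _ /=; rewrite expgS invgM -!mulgA mulKg.
Qed.

Lemma final_levelE (X : choiceType) (t : X) n w :
  size w <= n -> Posz (final_level t n w) = (Posz n - wexp t w)%R.
Proof.
elim: w n => [|[x b] w IH] n /= wn.
  by rewrite /wexp ev_nil [RHS]GRing.subr0.
rewrite /wexp ev_cons -/(wexp t w) intgM /ev_letter /=.
case: eqP => _ /=; rewrite IH; try by case: b; lia.
all: case: b wn => wn; rewrite ?intgV; lia.
Qed.

Lemma ev_rewrite_levels0 (X : choiceType) (G : groupType) (f : X -> G) t n w :
  size w <= n -> wexp t w = 1 ->
  ev (level_conjugate f t) (rewrite_levels t n w) = ev f w ^ (f t ^+ n).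
Proof.
move=> wn w0; have := ev_rewrite_levels f t wn.
have -> : final_level t n w = n by have := final_levelE t wn; rewrite w0 intg1; lia.
by rewrite /conjg mulgA => ->; rewrite mulgVK.
Qed.

Lemma letters_rewrite_levels (X : choiceType) (t : X) n w z :
  z \in letters (rewrite_levels t n w) -> z.1 != t /\ z.1 \in letters w.
Proof.
elim: w n => //= -[x b] w IH n; rewrite inE.
case: eqP => /= [_ /IH[-> ->]|/eqP xt]; first by rewrite orbT.
by rewrite inE => /orP[/eqP->|/IH[-> ->]]; rewrite ?eqxx ?orbT.
Qed.

Lemma size_rewrite_levels (X : choiceType) (t : X) n w :
  size (rewrite_levels t n w) = count (fun l => l.1 != t) w.
Proof. by elim: w n => //= -[x b] w IH n; case: eqP => _ /=; rewrite IH. Qed.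

Lemma size_rewrite_levels_lt (X : choiceType) (t : X) n w :
  t \in letters w -> size (rewrite_levels t n w) < size w.
Proof.
move=> /mapP[l lw El]; rewrite size_rewrite_levels.
rewrite -(count_predC (fun l : X * bool => l.1 != t) w) -[ltnLHS]addn0 ltn_add2l.
by rewrite -has_count; apply/hasP; exists l; rewrite //= negbK El.
Qed.

Lemma wexp_entails (X : choiceType) (x : X) (w u : word X) :
  entails w u -> wexp x w = 1 -> wexp x u = 1.
Proof. by move=> wu; apply: wu. Qed.

Lemma letters_relabel (X Y : choiceType) (s : X -> Y) (u : word X) :
  letters (relabel s u) = [seq s x | x <- letters u].
Proof. by rewrite /letters /unzip1 /relabel -!map_comp. Qed.

Lemma letters_cat (X : choiceType) (u v : word X) :
  letters (u ++ v) = letters u ++ letters v.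
Proof. exact: map_cat. Qed.

Lemma letters_winv (X : choiceType) (u : word X) :
  letters (winv u) =i letters u.
Proof.
move=> x; rewrite /letters /unzip1 /winv map_rev mem_rev -map_comp.
by congr (x \in _); apply: eq_map => -[].
Qed.

Lemma relabel_winv (X Y : choiceType) (s : X -> Y) (u : word X) :
  relabel s (winv u) = winv (relabel s u).
Proof. by rewrite /relabel /winv map_rev -!map_comp. Qed.

(** If the relabelling s of the letters in P induces an isomorphism between two
    subgroups of the one-relator group of v, that isomorphism becomes a
    conjugation in a larger group. *)
Lemma conjugating_model (X : choiceType) (v : word X) (P : X -> Prop) (s : X -> X) :
  (forall u, (forall x, x \in letters u -> P x) ->
     entails v u <-> entails v (relabel s u)) ->
  exists (G : groupType) (f : X -> G) (t : G),
    (forall u, ev f u = 1 <-> entails v u) /\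
    (forall x, P x -> f (s x) = f x ^ t).
Proof.
move=> sP.
pose D (x y : pres v) := exists u,
  [/\ forall x, x \in letters u -> P x, x = pres_cls v u &
      y = pres_cls v (relabel s u)].
have clsM a b : pres_cls v (a ++ b) = pres_cls v a * pres_cls v b.
  by rewrite -!ev_pres ev_cat.
have clsV a : pres_cls v (winv a) = (pres_cls v a)^-1.
  by rewrite -!ev_pres ev_inv.
have cls1 a : pres_cls v a = 1 <-> entails v a by rewrite -ev_pres ev_pres1.
have [||||G [i [t [iM i_inj it]]]] := @partial_isomorphism_conjugation (pres v) D.
- by exists [::].
- move=> _ _ _ _ [a [Pa -> ->]] [b [Pb -> ->]]; exists (a ++ b); split.
  + by move=> x; rewrite letters_cat mem_cat => /orP[/Pa|/Pb].
  + by rewrite clsM.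
  + by rewrite /relabel map_cat clsM.
- move=> _ _ [a [Pa -> ->]]; exists (winv a); split.
  + by move=> x; rewrite letters_winv => /Pa.
  + by rewrite clsV.
  + by rewrite relabel_winv clsV.
- by move=> _ _ [a [Pa -> ->]]; rewrite !cls1; apply: sP.
exists G, (i \o pres_gen v), t; split=> [u|x Px].
  rewrite -ev_hom // -ev_pres1 -{1}(morph1 iM).
  by split=> [/i_inj|->].
apply: it; exists [:: (x, false)]; split=> // y.
by rewrite inE => /eqP->.
Qed.

(** Each letter of v is needed for a nontrivial consequence of v: the remaining
    letters freely generate a subgroup of the one-relator group of v. *)
Definition freiheit (X : choiceType) (v : word X) : Prop :=
  forall x u, x \in letters v -> x \notin letters u -> entails v u ->
  trivial_word u.

Lemma trivial_entails (X : choiceType) (v u : word X) :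
  trivial_word u -> entails v u.
Proof. by move=> tu G f _; apply: tu. Qed.

Lemma trivial_relabel (X Y : choiceType) (s : X -> Y) (u : word X) :
  trivial_word u -> trivial_word (relabel s u).
Proof. by move=> tu G f; rewrite ev_relabel. Qed.

(** The levels at which y occurs in v range from mu to M. Restrict y to the levels
    from mu to M - 1: these letters avoid (y, M), and raised by one level they
    avoid (y, mu), so by hypothesis both families are free in the one-relator
    group of v and the shift of levels is an isomorphism between the subgroups
    that they generate. Letting t act as an element that realizes this shift by
    conjugation turns a model of v into a model of w; among the words on which y
    keeps to the levels from mu to M, only consequences of v are trivial there. *)
Lemma stable_letter_model (X : choiceType) (t y : X) (w : word X) n
  (v : word (X * nat)%type) mu M :
  y != t -> size w <= n -> wexp t w = 1 ->
  conj_words v (rewrite_levels t n w) ->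
  (forall z, z \in letters v -> z.1 != t) -> freiheit v ->
  (y, mu) \in letters v -> (y, M) \in letters v ->
  (forall i, (y, i) \in letters v -> mu <= i <= M) ->
  exists (G : groupType) (g : X -> G), ev g w = 1 /\
    forall u : word (X * nat)%type,
      (forall z, z \in letters u -> z.1 != t /\ (z.1 = y -> mu <= z.2 <= M)) ->
      ev (level_conjugate g t) u = 1 -> entails v u.
Proof.
move=> yt wn w0 vw vt freev muv Mv vy.
pose P (z : X * nat) := z.1 = y -> mu <= z.2 < M.
pose up (z : X * nat) := (z.1, z.2.+1).
have [|G [f [tau [fv ftau]]]] := @conjugating_model _ v P up.
  move=> u uP; transitivity (trivial_word u).
    split=> [vu|]; last exact: trivial_entails.
    apply: (freev (y, M)) => //; apply/negP => /uP /(_ erefl) /=; lia.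
  transitivity (trivial_word (relabel up u)); last first.
    split=> [|vu]; first exact: trivial_entails.
    apply: (freev (y, mu)) => //; apply/negP.
    by rewrite letters_relabel => /mapP[[c i] /uP ui [yc Ei]]; have /= := ui (esym yc); lia.
  split; first exact: trivial_relabel.
  move=> /(@trivial_relabel _ _ (fun z => (z.1, z.2.-1))) tu G f.
  by rewrite -[RHS](tu G f) !ev_relabel; apply: ev_eq_in => -[].
(* The letter y need not occur on level 0, so its value is read off on level mu
   and conjugated back. *)
pose g c := if c == t then tau else
  if c == y then f (y, mu) ^ (tau ^- mu) else f (c, 0).
have liftE z : z.1 != t -> (z.1 = y -> mu <= z.2 <= M) -> level_conjugate g t z = f z.
  case: z => c i /= ct; rewrite /level_conjugate /g /= (negbTE ct) eqxx.
  case: eqP => [->|cy].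
    move=> /(_ erefl) /andP[mui iM]; rewrite -(subnKC mui) in iM *.
    elim: (i - mu) iM => [|k IH] kM; first by rewrite addn0 conjgKV.
    rewrite addnS in kM *; rewrite expgSr conjgM IH; last exact: ltnW.
    by rewrite -ftau // => _ /=; rewrite leq_addr.
  move=> _; elim: i => [|i IH]; first by rewrite conjg1.
  by rewrite expgSr conjgM IH -ftau // => /= Ecy; case: cy.
exists G, g; split.
  have v1 : ev (level_conjugate g t) v = 1.
    rewrite (@ev_eq_in _ _ _ f); first exact/fv.
    move=> z zv; apply: liftE; first exact: vt.
    by case: z zv => c i /= zv Ec; apply: vy; rewrite -Ec.
  move/eqP: (conj_words_ev1 vw v1).
  by rewrite ev_rewrite_levels0 // conjg_eq1 => /eqP.
move=> u uP u1; apply/fv; rewrite -u1; apply: ev_eq_in => z /uP[zt zy].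
by rewrite liftE.
Qed.

(** * The Freiheitssatz *)

Lemma level_range (X : choiceType) (v : word (X * nat)%type) y i :
  (y, i) \in letters v -> exists mu M,
    [/\ (y, mu) \in letters v, (y, M) \in letters v &
        forall j, (y, j) \in letters v -> mu <= j <= M].
Proof.
move=> yi; have ex_i : exists i, (y, i) \in letters v by exists i.
have ub j : (y, j) \in letters v -> j <= \max_(z <- letters v) z.2.
  by move=> yj; rewrite (big_rem _ yj) /= leq_max leqnn.
case: (ex_minnP ex_i) => mu muv mu_min; case: (ex_maxnP ex_i ub) => M Mv M_max.
by exists mu, M; split=> // j jv; rewrite mu_min ?M_max.
Qed.

Lemma minimal_rewrite_levels (X : choiceType) (t : X) n w :
  exists v, [/\ conj_words v (rewrite_levels t n w), minimal v,
    size v <= size (rewrite_levels t n w) &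
    forall z, z \in letters v -> z.1 != t /\ z.1 \in letters w].
Proof.
have [v [vw min_v le_vw]] := minimal_conjugate (rewrite_levels t n w).
exists v; split=> // z /(minimal_letters min_v (conj_words_sym vw)).
exact: letters_rewrite_levels.
Qed.

Lemma ev_one_level (X : choiceType) (G : groupType) (f : X -> G) t k
  (v : word (X * nat)%type) :
  (forall z, z \in letters v -> z.2 = k) ->
  ev (level_conjugate f t) v = ev f (relabel fst v) ^ (f t ^+ k).
Proof.
move=> vk; rewrite ev_relabel -ev_conjg; apply: ev_eq_in => z /vk zk.
by rewrite /level_conjugate zk.
Qed.

(** If v stays on one level then, up to conjugacy, w can be written without t. *)
Lemma one_level_conj (X : choiceType) (t : X) n w k (v : word (X * nat)%type) :
  size w <= n -> wexp t w = 1 -> conj_words v (rewrite_levels t n w) ->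
  (forall z, z \in letters v -> z.2 = k) -> conj_words (relabel fst v) w.
Proof.
move=> wn w0 vw vk G f; have [g] := vw G (level_conjugate f t).
rewrite ev_rewrite_levels0 // (ev_one_level _ _ vk) => E.
exists (f t ^+ n * (g * f t ^- k)).
by rewrite !conjgM -E conjgK.
Qed.

Lemma one_or_two_levels (X : choiceType) (v : word (X * nat)%type) :
  (exists k, forall z, z \in letters v -> z.2 = k) \/
  (exists y z, [/\ y \in letters v, z \in letters v & y.2 != z.2]).
Proof.
case Ev: (letters v) => [|y s]; first by left; exists 0.
case: (boolP (all (fun z => y.2 == z.2) (letters v))) => [/allP vy|/allPn[z zv yz]].
  by left; exists y.2; rewrite -Ev => z /vy/eqP.
by right; exists y, z; rewrite -Ev; split=> //; rewrite Ev mem_head.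
Qed.

(** Since t cannot be avoided in w, the rewritten word v meets two levels. A word
    without t can be placed on any level, and is there disjoint from some letter
    of v, so the statement for v applies to it. *)
Lemma freiheit_exponent_zero (X : choiceType) (t : X) (w u : word X) :
  (forall v : word (X * nat)%type, size v < size w -> minimal v -> freiheit v) ->
  minimal w -> t \in letters w -> wexp t w = 1 ->
  t \notin letters u -> entails w u -> trivial_word u.
Proof.
move=> IH min_w tw w0 tu wu.
have [v [vw min_v le_vw vt]] := minimal_rewrite_levels t (size w) w.
have freev : freiheit v.
  by apply: IH => //; apply: leq_ltn_trans le_vw (size_rewrite_levels_lt _ _).
case: (one_or_two_levels v) => [[k vk]|[[y i] [z [yv zv yz]]]].
  have /(minimal_letters min_w)/(_ t tw) := one_level_conj (leqnn _) w0 vw vk.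
  by rewrite letters_relabel => /mapP[z /vt[/eqP zt _]] /esym.
have [mu [M [muv Mv vy]]] := level_range yv.
have yt : y != t by case: (vt _ yv).
have vt' z' : z' \in letters v -> z'.1 != t by case/vt.
have [G [g [gw gu]]] :=
  stable_letter_model yt (leqnn _) w0 vw vt' freev muv Mv vy.
pose u' : word (X * nat)%type := relabel (fun c => (c, mu)) u.
have vu' : entails v u'.
  apply: gu => [z'|].
    rewrite letters_relabel => /mapP[c cu ->] /=.
    split=> [|_]; first by apply: contraNneq tu => <-.
    by have /andP[] := vy _ muv; rewrite leqnn.
  by rewrite ev_relabel (ev_conjg g (g t ^+ mu)) wu // conj1g.
have [z' z'v z'mu] : exists2 z', z' \in letters v & z'.2 != mu.
  case: (eqVneq i mu) => [Ei|]; last by exists (y, i).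
  by exists z => //; rewrite -Ei eq_sym.
have tu' : trivial_word u'.
  apply: freev z'v _ vu'; apply: contra z'mu.
  by rewrite letters_relabel => /mapP[c _ ->].
move: tu' => /(trivial_relabel fst) tu' G' f; rewrite -[RHS](tu' G' f).
by rewrite !ev_relabel.
Qed.

(** Here x is omitted and another letter t is stable. As the exponent sum of x in w
    is not zero, x occurs on some level of the rewritten word v, while a
    consequence of w without x has exponent sum zero in t and rewrites to a
    consequence of v that avoids x on every level. *)
Lemma freiheit_stable_letter (X : choiceType) (t x : X) (w u : word X) :
  (forall v : word (X * nat)%type,
     size v <= count (fun l => l.1 != t) w -> minimal v -> freiheit v) ->
  x != t -> wexp t w = 1 -> wexp x w <> 1 ->
  x \notin letters u -> entails w u -> trivial_word u.
Proof.
move=> IH xt w0 wx xu wu; pose n := size w + size u.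
have wn : size w <= n by rewrite leq_addr.
have un : size u <= n by rewrite leq_addl.
have [v [vw min_v le_vw vt]] := minimal_rewrite_levels t n w.
have freev : freiheit v by apply: IH => //; rewrite -(size_rewrite_levels t n).
have [i xi] : exists i, (x, i) \in letters v.
  apply: contrapT => noxv; apply: wx.
  (* Counting x gives w a nonzero value, but it would give v the value zero. *)
pose delta (y : X) : intg := Posz (y == x).
  have v1 : ev (level_conjugate delta t) v = 1.
    apply: ev_one => -[y i] yv.
    rewrite /level_conjugate /delta /=; case: eqP => [yx|_]; last exact: conj1g.
    by case: noxv; exists i; rewrite -yx.
  move/eqP: (conj_words_ev1 vw v1).
  by rewrite ev_rewrite_levels0 // conjg_eq1 => /eqP.
have [mu [M [muv Mv vx]]] := level_range xi.
have vt' z' : z' \in letters v -> z'.1 != t by case/vt.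
have [G [g [gw gu]]] := stable_letter_model xt wn w0 vw vt' freev muv Mv vx.
have u0 : wexp t u = 1 := wexp_entails wu w0.
have ru z : z \in letters (rewrite_levels t n u) -> z.1 != t /\ z.1 != x.
  move=> /letters_rewrite_levels[zt zu]; split=> //.
  by apply: contraNneq xu => <-.
have tru : trivial_word (rewrite_levels t n u).
  apply: freev Mv _ _; first by apply/negP => /ru /=; rewrite eqxx => -[].
  apply: gu => [z /ru[zt /eqP zx]|]; first by split=> // /zx.
  by rewrite ev_rewrite_levels0 // wu // conj1g.
move=> G' f; move/eqP: (tru G' (level_conjugate f t)).
by rewrite ev_rewrite_levels0 // conjg_eq1 => /eqP.
Qed.

Definition letter_power (X : choiceType) (x : X) (k : int) : word X :=
  nseq `|k|%N (x, (k < 0)%R).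

Lemma ev_letter_power (X : choiceType) (G : groupType) (f : X -> G) x k :
  ev f (letter_power x k) =
  if (k < 0)%R then f x ^- `|k|%N else f x ^+ `|k|%N.
Proof.
rewrite /letter_power; elim: `|k|%N => [|n IH] /=.
  by rewrite ev_nil; case: ifP; rewrite // expg0 invg1.
rewrite ev_cons IH /ev_letter /=; case: ifP => _; last by rewrite expgS.
by rewrite expgSr invgM.
Qed.

Lemma intgX (a : intg) n : a ^+ n = (a *+ n)%R :> intg.
Proof. by elim: n => // n IH; rewrite expgS IH GRing.mulrS. Qed.

Lemma wexp_letter_power (X : choiceType) (x y : X) k :
  wexp y (letter_power x k) = (if x == y then k else 0%R) :> intg.
Proof.
rewrite /wexp ev_letter_power !intgX intgV; case: eqP => _ /=; last first.
  by rewrite !GRing.mul0rn /= if_same.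
by case: ifP => /= k0; rewrite natz; lia.
Qed.

Lemma ev_intg_linear (X : choiceType) (x y : X) (a c : int) (w : word X) :
  ev (fun z => (a * (z == x)%:Z + c * (z == y)%:Z)%R : intg) w =
  (a * wexp x w + c * wexp y w)%R :> intg.
Proof.
elim: w => [|[z b] w IH].
  by rewrite /wexp !ev_nil !GRing.mulr0.
rewrite /wexp !ev_cons -/(wexp x w) -/(wexp y w) !intgM {}IH /ev_letter /=.
case: b; rewrite ?intgV; ring.
Qed.

Lemma count_winv (X : choiceType) (p : pred X) (w : word X) :
  count (fun l => p l.1) (winv w) = count (fun l => p l.1) w.
Proof. by rewrite /winv count_rev count_map. Qed.

Lemma letters_subst (X Y : choiceType) (s : X -> word Y) w y :
  y \in letters (subst s w) -> exists2 x, x \in letters w & y \in letters (s x).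
Proof.
elim: w => [|[x b] w IH] //=; rewrite letters_cat mem_cat => /orP[|/IH].
  by case: b; rewrite ?letters_winv => ys; exists x; rewrite ?mem_head.
by case=> z zw ys; exists z; rewrite // inE zw orbT.
Qed.

(** When p and q are the exponent sums of x and b in w, this substitution makes the
    exponent sum of b vanish and keeps the number of letters other than b. *)
Definition balance (X : choiceType) (x b : X) (p q : int) (y : X) : word X :=
  if y == x then (x, false) :: letter_power b (- q)
  else if y == b then letter_power b p else [:: (y, false)].

Lemma wexp_balance_omitted (X : choiceType) (x b : X) (p q : int) w : x != b ->
  wexp x (subst (balance x b p q) w) = wexp x w.
Proof.
move=> xb; have := ev_intg_linear x b 1 0 w.
rewrite !GRing.mul1r !GRing.mul0r GRing.addr0 => <-; rewrite /wexp ev_subst.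
apply: ev_eq_in => y _; rewrite -/(wexp _ _) /balance.
case: (eqVneq y x) => [->|yx].
  rewrite /wexp ev_cons /ev_letter -/(wexp _ _) wexp_letter_power /=.
  by rewrite eqxx eq_sym (negbTE xb).
case: (eqVneq y b) => [_|yb].
  by rewrite wexp_letter_power eq_sym (negbTE xb).
by rewrite /wexp ev1 (negbTE yx).
Qed.

Lemma wexp_balance_stable (X : choiceType) (x b : X) (p q : int) w : x != b ->
  wexp b (subst (balance x b p q) w) = (- q * wexp x w + p * wexp b w)%R.
Proof.
move=> xb; rewrite -ev_intg_linear /wexp ev_subst.
apply: ev_eq_in => y _; rewrite -/(wexp _ _) /balance.
case: (eqVneq y x) => [->|yx].
  rewrite /wexp ev_cons /ev_letter -/(wexp _ _) wexp_letter_power /=.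
  rewrite eqxx (negbTE xb) intgM; lia.
case: (eqVneq y b) => [_|yb].
  by rewrite wexp_letter_power eqxx; lia.
rewrite /wexp ev1 (negbTE yb); lia.
Qed.

Lemma count_balance (X : choiceType) (x b : X) (p q : int) w : x != b ->
  count (fun l => l.1 != b) (subst (balance x b p q) w) =
  count (fun l => l.1 != b) w.
Proof.
move=> xb; elim: w => //= -[y e] w IH; rewrite count_cat -/(subst _ w) IH /=.
congr (_ + _); transitivity (count (fun l => l.1 != b) (balance x b p q y)).
  by case: e; rewrite // (count_winv (fun z => z != b)).
have pow k : count (fun l => l.1 != b) (letter_power b k) = 0.
  by rewrite /letter_power count_nseq /= eqxx.
rewrite /balance; case: (eqVneq y x) => [->|yx] /=; first by rewrite pow xb.
by case: (eqVneq y b) => [_|yb] /=; rewrite ?pow ?yb.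
Qed.

(** On words without x the substitution only replaces b by its p-th power, and in a
    larger group every element b is the p-th power of some element. *)
Lemma trivial_balance (X : choiceType) (x b : X) (p q : int) u :
  p <> 0%R -> x != b -> x \notin letters u ->
  trivial_word (subst (balance x b p q) u) -> trivial_word u.
Proof.
move=> p0 xb xu tu G h.
have [|G' [i [c [iM i_inj ci]]]] :=
  @adjoin_root G (if (p < 0)%R then (h b)^-1 else h b) `|p|%N; first by lia.
apply: i_inj; rewrite (morph1 iM) ev_hom //.
rewrite -(tu G' (fun y => if y == b then c else i (h y))) ev_subst.
apply: ev_eq_in => y yu; rewrite /balance /=.
have -> : (y == x) = false by apply: contraNF xu => /eqP <-.
case: (eqVneq y b) => [->|yb]; last by rewrite ev1 (negbTE yb).
rewrite ev_letter_power eqxx ci.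
by case: (p < 0)%R; rewrite // (morphV iM) invgK.
Qed.

(** The Freiheitssatz of Magnus, by induction on the length of w. Rewriting along a
    letter of exponent sum zero removes the occurrences of that letter and so
    shortens w. The omitted letter x itself serves if its exponent sum is zero;
    otherwise another letter of w is balanced against x first. *)
Theorem freiheitssatz (X : choiceType) (w : word X) : minimal w -> freiheit w.
Proof.
have [n] := ubnP (size w); elim: n X w => // n IH X w wn min_w x u xw xu wu.
have [w0|wx] := pselect (wexp x w = 1).
  apply: (freiheit_exponent_zero _ min_w xw w0 xu wu) => v vw.
  by apply: IH; apply: leq_trans vw _.
case: (boolP (all (fun y => y == x) (letters w))) => [/allP w_x|].
  (* If x is the only letter of w, every group is a model of w once x is sent to 1. *)
  move=> G f; pose f1 y := if y == x then 1 else f y.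
  rewrite -(ev_avoid f 1 xu) -/f1; apply: wu.
  by apply: ev_one => y /w_x; rewrite /f1 => ->.
move=> /allPn[b bw]; rewrite eq_sym => xb.
set p := wexp x w in wx; pose q := wexp b w.
apply: (@trivial_balance _ x b p q) => //.
apply: (@freiheit_stable_letter _ b x (subst (balance x b p q) w)) => //.
- move=> v; rewrite count_balance // => le_vw; apply: IH.
  have := size_rewrite_levels_lt 0 bw; rewrite size_rewrite_levels => lt_w.
  exact: leq_ltn_trans le_vw (leq_trans lt_w _).
- by rewrite wexp_balance_stable // -/p -/q intg1; lia.
- by rewrite wexp_balance_omitted.
- apply/negP => /letters_subst[y yu]; rewrite /balance.
  have /negbTE -> : y != x by apply: contraNneq xu => <-.
  case: (eqVneq y b) => [_|yb].
    by rewrite /letters /letter_power /unzip1 map_nseq mem_nseq (negbTE xb) andbF.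
  by rewrite inE => /eqP Exy; rewrite Exy yu in xu.
- by move=> G f; rewrite !ev_subst; apply: wu.
Qed.

(** * Relators in two generators *)

Lemma one_letter_word (X : choiceType) (x : X) (w : word X) :
  (forall y, y \in letters w -> y = x) ->
  exists n e, forall (G : groupType) (f : X -> G), ev f w = ev f (nseq n (x, e)).
Proof.
elim: w => [|[y b] w IH] wx; first by exists 0, false => G f; rewrite ev_nil.
have [z zw|n [e we]] := IH; first by apply: wx; rewrite inE zw orbT.
have -> : y = x by apply: wx; rewrite inE eqxx.
case: n we => [|n] we.
  by exists 1%N, b => G f; rewrite !ev_cons we.
case: (eqVneq b e) => [->|be].
  by exists n.+2, e => G f; rewrite ev_cons we -ev_cons.
exists n, e => G f; rewrite ev_cons we /= ev_cons mulgA.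
by case: b be {wx}; case: e {we} => // _; rewrite /ev_letter /= ?mulgV ?mulVg mul1g.
Qed.

Lemma ev_nseq_false (X : choiceType) (G : groupType) (f : X -> G) n x e :
  f x ^+ n = 1 -> ev f (nseq n (x, e)) = 1.
Proof.
move=> fxn; suff -> : ev f (nseq n (x, e)) = if e then f x ^- n else f x ^+ n.
  by rewrite fxn invg1 if_same.
elim: n {fxn} => [|n IH] /=; first by rewrite ev_nil expg0 invg1 if_same.
by rewrite ev_cons IH; case: e {IH}; rewrite /ev_letter /= ?expgS // -expgS expgSr invgM.
Qed.

Definition commutator_word : word bool :=
  [:: (false, false); (true, false); (false, true); (true, true)].

Lemma ev_commutator (G : groupType) (f : bool -> G) :
  ev f commutator_word = f false * f true * (f false)^-1 * (f true)^-1.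
Proof. by rewrite !ev_cons ev_nil /ev_letter /= mulg1 !mulgA. Qed.

Lemma entails_power (u : word bool) n e :
  entails (nseq n (false, e)) u ->
  (forall (G : groupType) (f : bool -> G), ev f u = 1 -> commute (f false) (f true)) ->
  n = 1%N.
Proof.
move=> nu uf; apply: contrapT => /eqP /noncommuting_torsion[G [a [b [an]]]]; apply.
pose f c := if c then b else a.
by apply: (uf G f); apply: nu; apply: ev_nseq_false.
Qed.

(** The letter true is stable, and every letter of the rewritten word v lies above
    false. Either v lives on one level, and then w is conjugate to a power of the
    generator false, or it meets at least two levels, and then g is a model of w
    in which words between the extreme levels mu and M are trivial only if they
    are consequences of v. *)
Lemma power_or_levels (w : word bool) : wexp true w = 1 ->
  (exists n e, conj_words (nseq n (false, e)) w) \/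
  exists (v : word (bool * nat)%type) mu M (G : groupType) (g : bool -> G),
  [/\ mu < M, conj_words v (rewrite_levels true (size w) w) /\ freiheit v,
     (false, mu) \in letters v /\ (false, M) \in letters v,
     (forall z, z \in letters v -> z.1 = false /\ mu <= z.2 <= M) &
     ev g w = 1 /\ forall u : word (bool * nat)%type,
      (forall z, z \in letters u -> z.1 = false /\ mu <= z.2 <= M) ->
      ev (level_conjugate g true) u = 1 -> entails v u].
Proof.
move=> w0.
have [v [vw min_v le_vw vt]] := minimal_rewrite_levels true (size w) w.
have vF z : z \in letters v -> z.1 = false by case/vt => /negbTE; case: z.1.
case: (one_or_two_levels v) => [[k vk]|[y [z [yv zv yz]]]]; [left|right].
  have vw' := one_level_conj (leqnn _) w0 vw vk.
  have [|n [e ve]] := @one_letter_word _ false (relabel fst v).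
    by move=> c; rewrite letters_relabel => /mapP[z /vF zF ->].
  by exists n, e => G f; rewrite -ve; apply: vw'.
have [mu [M [muv Mv vM]]] : exists mu M, [/\ (false, mu) \in letters v,
    (false, M) \in letters v & forall j, (false, j) \in letters v -> mu <= j <= M].
  by apply: (@level_range _ _ _ y.2); rewrite -(vF _ yv) -surjective_pairing.
have vM' z' : z' \in letters v -> z'.1 = false /\ mu <= z'.2 <= M.
  by move=> z'v; split; [exact: vF|apply: vM; rewrite -(vF _ z'v) -surjective_pairing].
have freev := freiheitssatz min_v.
have vt' z' : z' \in letters v -> z'.1 != true by case/vt.
have [G [g [gw gu]]] :=
  @stable_letter_model _ true false w _ v _ _ isT (leqnn _) w0 vw vt' freev muv Mv vM.
exists v, mu, M, G, g; split=> //.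
  by have [_] := vM' _ yv; have [_] := vM' _ zv; move/eqP: yz; lia.
by split=> // u uM; apply: gu => z' /uM[-> ?].
Qed.

(** The exponent sum of true vanishes in w, by mapping both generators to suitable
    integers. If w were not conjugate to a power of the generator false, that
    generator, placed on the lowest level mu, would be a consequence of v avoiding
    the letter on the highest level M. *)
Lemma root_of_generator (w : word bool) :
  entails w [:: (false, false)] -> exists e, conj_words [:: (false, e)] w.
Proof.
move=> wa; have w0 : wexp true w = 1.
  have := wa intg (fun z => (wexp true w * (z == false)%:Z +
    (- wexp false w) * (z == true)%:Z)%R : intg).
  rewrite ev_intg_linear ev1 /= !GRing.mulr1 !GRing.mulr0 GRing.addr0; apply.
  by rewrite GRing.mulNr GRing.mulrC GRing.addrN.
have [[n [e we]]|[v [mu [M [G [g [muM [vw freev] [muv Mv] vM [gw gu]]]]]]]] :=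
  power_or_levels w0.
  exists e; suff n1 : n = 1%N by rewrite n1 in we.
  apply: (@entails_power [:: (false, false)] n e) => [G f ne|G f].
    by apply: wa; apply: conj_words_ev1 we _.
  by rewrite ev1 => ->; apply: commute_sym; apply: commute1.
have vmu : entails v [:: ((false, mu), false)].
  apply: gu => [z|]; first by rewrite inE => /eqP-> /=; split=> //; lia.
  by rewrite ev1 /level_conjugate; have := wa G g gw; rewrite ev1 /= => ->; rewrite conj1g.
have /(_ intg (fun=> Posz 1)) : trivial_word [:: ((false, mu), false)].
  by apply: (freev (false, M)) => //; rewrite inE; apply/negP => /eqP[]; lia.
by rewrite ev1.
Qed.

Lemma ev_level_commutator (G : groupType) (g : bool -> G) m :
  ev (level_conjugate g true) [:: ((false, m.+1), false); ((false, m), true)] =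
  ev g commutator_word ^ (g true ^+ m.+1).
Proof.
rewrite ev_commutator !ev_cons ev_nil mulg1 /ev_letter /level_conjugate /=.
rewrite expgS !conjgM -!conjVg -!conjMg; congr (_ ^ _).
by rewrite /conjg !mulgA mulgVK.
Qed.

(** In the case of several levels, the quotient of the letters on the levels mu + 1
    and mu is a consequence of v. By the Freiheitssatz it involves the highest
    level, so v is a word in just these two letters. Their quotient belongs to a
    basis of the free group on them, hence v is conjugate to the quotient or to
    its inverse. *)
Lemma root_of_commutator_word (w : word bool) :
  wexp true w = 1 -> entails w commutator_word ->
  (exists e, conj_words [:: (false, e)] w) \/
  (conj_words commutator_word w \/ conj_words (winv commutator_word) w).
Proof.
move=> w0 wc.
have [[n [e we]]|[v [mu [M [G [g [muM [vw freev] [muv Mv] vM [gw gu]]]]]]]] :=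
  power_or_levels w0; [left|right].
  exists e; suff n1 : n = 1%N by rewrite n1 in we.
  apply: (@entails_power commutator_word n e) => [G f ne|G f].
    by apply: wc; apply: conj_words_ev1 we _.
  by rewrite ev_commutator -mulgA -invgM => /divg1_eq.
pose u : word (bool * nat)%type :=
  [:: ((false, mu.+1), false); ((false, mu), true)].
have vu : entails v u.
  apply: gu => [z|]; last by rewrite ev_level_commutator wc // conj1g.
  by rewrite !inE => /orP[] /eqP-> /=; split=> //; lia.
have EM : M = mu.+1.
  apply: contrapT => neM.
  have /(_ intg (fun z => Posz (z.2 == mu))) : trivial_word u.
    apply: (freev (false, M)) => //; rewrite !inE.
    by apply/negP => /orP[] /eqP[]; lia.
  by rewrite !ev_cons ev_nil /ev_letter /= eqxx gtn_eqF.
(* New free generators: true for the letter on level mu, and false for the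
   quotient of the letters on levels mu + 1 and mu. *)
pose s (z : bool * nat) : word bool :=
  if z.2 == mu then [:: (true, false)] else [:: (false, false); (true, false)].
have s_mu (G' : groupType) (f : bool -> G') : ev f (s (false, mu)) = f true.
  by rewrite /s eqxx ev1.
have s_M (G' : groupType) (f : bool -> G') :
    ev f (s (false, mu.+1)) = f false * f true.
  by rewrite /s gtn_eqF //= ev_cons ev1.
have [|e ve] := @root_of_generator (subst s v).
  move=> G' f; rewrite ev_subst => /vu.
  by rewrite !ev_cons !ev_nil !mulg1 /ev_letter /= s_mu s_M mulgK.
have ve' : conj_words (if e then winv u else u) v.
  move=> G' f; pose f1 c := if c then f (false, mu) else f (false, mu.+1) / f (false, mu).
  have [h] := ve G' f1; rewrite ev_subst.
  have -> : ev (fun z => ev f1 (s z)) v = ev f v.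
    apply: ev_eq_in => -[c i] /vM /= [-> iM].
    have [->|->] : i = mu \/ i = mu.+1 by lia.
      by rewrite s_mu.
    by rewrite s_M mulgVK.
  move=> Eh; exists h; rewrite -Eh ev1 (fun_if (ev f)) ev_inv !ev_cons !ev_nil.
  by rewrite /ev_letter /= mulg1.
have com : conj_words (if e then winv commutator_word else commutator_word) w.
  move=> G' f; have [h] := ve' G' (level_conjugate f true).
  have [h'] := vw G' (level_conjugate f true).
  rewrite ev_rewrite_levels0 // => ->; rewrite (fun_if (ev _)) ev_inv ev_level_commutator.
  rewrite -conjVg -(fun_if (fun x => x ^ _)) -ev_inv -(fun_if (ev f)).
  move=> /(canRL (conjgK _)) ->; exists (f true ^+ size w * (h' * (h * f true ^- mu.+1))).
  by rewrite !conjgM.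
by move: com; case: (e); [right|left].
Qed.

(** * Bases of the free group of rank two *)

Definition pair_fun (T : Type) (x y : T) (c : bool) : T := if c then y else x.

Definition free_pair (F : groupType) (a b : F) : Prop :=
  (forall z : F, exists w, z = ev (pair_fun a b) w) /\
  (forall (G : groupType) (x y : G), exists h : F -> G,
     [/\ {morph h : x y / x * y}, h a = x & h b = y]).

(** F maps to the free group on two letters and back; the composite fixes a and b,
    so it is the identity by uniqueness, and every element is the value of a word. *)
Lemma free_basis_pair (F : groupType) (a b : F) :
  a <> b -> free_basis [set a; b]%classic -> free_pair a b.
Proof.
move=> ab Fab.
have hom (G : groupType) (x y : G) :
    exists h : F -> G, [/\ {morph h : x y / x * y}, h a = x & h b = y].
  have [h hab _] := Fab G (fun z => if z == a then x else y).
  exists h; split; first exact: gmulfM.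
    by rewrite hab ?eqxx //; left.
  by rewrite hab; [case: eqP => // /esym|right].
split=> // z.
have [h [hM ha hb]] := hom (pres [::]) (pres_gen [::] false) (pres_gen [::] true).
pose k (x : pres [::]) : F := ev (pair_fun a b) (repr x).
have kcls u : k (pres_cls [::] u) = ev (pair_fun a b) u.
  by rewrite /k repr_clsP // ev_nil.
have kM : {morph k : x y / x * y}.
  elim/(@pres_ind bool [::]) => u; elim/(@pres_ind bool [::]) => v.
  by rewrite -[pres_cls _ u * _]/(pres_mul _ _) pres_mulE !kcls ev_cat.
have [h0 _ uniq_h0] := Fab F id.
pose kh : {multiplicative F -> F} := HB.pack (k \o h)
  (isMultiplicative.Build F F (k \o h) (fun x y => etrans (congr1 k (hM x y)) (kM _ _))).
exists (repr (h z)).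
have idE := uniq_h0 idfun (fun _ _ => erefl) z.
have khE := uniq_h0 kh _ z.
rewrite -[LHS]/(idfun z) idE -khE // => x [->|->] /=.
  by rewrite ha kcls ev1.
by rewrite hb kcls ev1.
Qed.

Lemma free_pair_basis (F : groupType) (a b : F) :
  free_pair a b -> free_basis [set a; b]%classic.
Proof.
move=> [gen hom] G f; have [h [hM ha hb]] := hom G (f a) (f b).
pose h1 : {multiplicative F -> G} := HB.pack h (isMultiplicative.Build F G h hM).
exists h1 => [x [->|->] //|h' h'ab z].
have [w ->] := gen z; rewrite [RHS](ev_hom _ _ hM) (ev_hom _ _ (@gmulfM _ _ h')).
by apply: ev_eq_in => -[] _ /=; rewrite h'ab ?ha ?hb //; [right|left].
Qed.

(** The substitutions s and s1 are mutually inverse: s writes the new generators in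
    terms of the old ones and s1 the old ones in terms of the new. *)
Lemma free_pair_change (F : groupType) (a b : F) (s s1 : bool -> word bool) :
  free_pair a b ->
  (forall (G : groupType) (f : bool -> G) c, ev (fun d => ev f (s d)) (s1 c) = f c) ->
  (forall (G : groupType) (f : bool -> G) c, ev (fun d => ev f (s1 d)) (s c) = f c) ->
  free_pair (ev (pair_fun a b) (s false)) (ev (pair_fun a b) (s true)) /\
  forall w, ev (pair_fun a b) w =
    ev (pair_fun (ev (pair_fun a b) (s false)) (ev (pair_fun a b) (s true)))
       (subst s1 w).
Proof.
move=> [gen hom] ss1 s1s; set a' := ev _ (s false); set b' := ev _ (s true).
have pairE c : pair_fun a' b' c = ev (pair_fun a b) (s c) by case: c.
have newE w : ev (pair_fun a b) w = ev (pair_fun a' b') (subst s1 w).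
  rewrite ev_subst; apply: ev_eq_in => c _; rewrite -[LHS]ss1.
  by apply: ev_eq_in => d _; rewrite pairE.
split=> //; split=> [z|G x y].
  by have [w ->] := gen z; exists (subst s1 w).
have [h [hM ha hb]] := hom G (ev (pair_fun x y) (s1 false)) (ev (pair_fun x y) (s1 true)).
have hE c : h (ev (pair_fun a b) (s c)) = pair_fun x y c.
  rewrite (ev_hom _ _ hM) -[RHS]s1s; apply: ev_eq_in => -[] _ //=.
by exists h; split=> //; rewrite hE.
Qed.

Lemma free_pair_conj (F : groupType) (a b g : F) :
  free_pair a b -> free_pair (a ^ g) (b ^ g).
Proof.
move=> [gen hom]; split=> [z|G x y].
  have [w wE] := gen (z ^ g^-1); exists w.
  rewrite -[LHS](conjgKV g) wE -ev_conjg; apply: ev_eq_in => -[] //.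
have [h [hM ha hb]] := hom G x y; exists (fun z => h z ^ (h g)^-1).
have hJ z : h (z ^ g) ^ (h g)^-1 = h z.
  by rewrite {1}/conjg !hM (morphV hM) -/(conjg _ _) conjgK.
by split=> [u v||]; [rewrite hM conjMg|rewrite hJ|rewrite hJ].
Qed.

Lemma free_pair_swap (F : groupType) (a b : F) : free_pair a b -> free_pair b a.
Proof.
move=> [gen hom]; split=> [z|G x y].
  have [w ->] := gen z; exists (relabel negb w); rewrite ev_relabel.
  by apply: ev_eq_in => -[].
by have [h [hM ha hb]] := hom G y x; exists h.
Qed.

Lemma free_pair_invl (F : groupType) (a b : F) : free_pair a b -> free_pair a^-1 b.
Proof.
move=> /(@free_pair_change _ a b (fun c => [:: (c, ~~ c)]) (fun c => [:: (c, ~~ c)])).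
rewrite !ev1 /=; case=> // G f [];
  by rewrite !ev_cons !ev_nil /ev_letter /= !ev1 !mulg1 ?invgK.
Qed.

Lemma free_pair_primitive (F : groupType) (a b : F) : free_pair a b -> primitive a.
Proof.
by move=> /free_pair_basis ab; exists [set a; b]%classic => //; left.
Qed.

Lemma root_morphism (F G : groupType) (R W : F) (h : F -> G) :
  is_root R W -> {morph h : x y / x * y} -> h R = 1 -> h W = 1.
Proof.
move=> RW hM hR.
apply: (@smallest_sub _ (@normal_subgroup F) [set R]%classic
  [set x | h x = 1]%classic _ _ W RW) => [|x -> //].
split=> /=; first exact: morph1.
- by move=> x y hx hy; rewrite hM hx hy mulg1.
- by move=> x hx; rewrite (morphV hM) hx invg1.
- by move=> x g hx; rewrite /conjg !hM hx mul1g (morphV hM) mulVg.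
Qed.

Lemma root_entails (F : groupType) (a b : F) (w u : word bool) : free_pair a b ->
  is_root (ev (pair_fun a b) w) (ev (pair_fun a b) u) -> entails w u.
Proof.
move=> [_ hom] wu G f fw; have [h [hM ha hb]] := hom G (f false) (f true).
have hE v : h (ev (pair_fun a b) v) = ev f v.
  by rewrite (ev_hom _ _ hM); apply: ev_eq_in => -[].
by rewrite -hE; apply: (root_morphism wu hM); rewrite hE.
Qed.

Definition root_conclusion (F : groupType) (R W : F) : Prop :=
  primitive R \/ (conjugate R W \/ conjugate R W^-1).

Lemma conj_words_conjugate (F : groupType) (f : bool -> F) (v w : word bool) :
  conj_words v w -> conjugate (ev f w) (ev f v).
Proof. by move=> /conj_words_sym vw; have [g E] := vw F f; exists g. Qed.

Lemma root_of_commutator_balanced (F : groupType) (a b : F) (w : word bool) :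
  free_pair a b -> wexp true w = 1 ->
  is_root (ev (pair_fun a b) w) (a * b * a^-1 * b^-1) ->
  root_conclusion (ev (pair_fun a b) w) (a * b * a^-1 * b^-1).
Proof.
move=> ab w0; rewrite -[X in is_root _ X](ev_commutator (pair_fun a b)).
rewrite -[X in root_conclusion _ X](ev_commutator (pair_fun a b)).
move=> /(root_entails ab)/(root_of_commutator_word w0)[[e]|[]] /conj_words_conjugate.
- move=> /(_ _ (pair_fun a b))[g ->]; left; apply: (@free_pair_primitive _ _ (b ^ g)).
  rewrite ev1 /=; case: e; apply: free_pair_conj => //; exact: free_pair_invl.
- by move=> /(_ _ (pair_fun a b)); right; left.
- by move=> /(_ _ (pair_fun a b)); rewrite ev_inv; right; right.
Qed.

Lemma root_inv (F : groupType) (R W : F) : is_root R W -> is_root R W^-1.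
Proof. by move=> RW N HN; case: (HN) => -[_ _ NV _] _; apply: NV; apply: RW. Qed.

Lemma commutatorV (F : groupType) (a b : F) :
  (a * b * a^-1 * b^-1)^-1 = b * a * b^-1 * a^-1.
Proof. by rewrite !invgM !invgK !mulgA. Qed.

(** The elementary change of basis that multiplies the generator k on the right by
    the other generator or its inverse. *)
Definition transvection (k e c : bool) : word bool :=
  if c == k then [:: (k, false); (~~ k, e)] else [:: (c, false)].

Lemma transvectionK k e (G : groupType) (f : bool -> G) c :
  ev (fun d => ev f (transvection k e d)) (transvection k (~~ e) c) = f c.
Proof.
by case: k e c => -[] []; rewrite /transvection /= !ev_cons !ev_nil /ev_letter /=
  ?ev_cons ?ev_nil /ev_letter /= ?mulg1 ?mulgK ?mulgVK.
Qed.

(** Transvections fix the commutator of the basis, not only up to conjugacy. *)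
Lemma transvection_commutator k e (G : groupType) (f : bool -> G) :
  let a' := ev f (transvection k e false) in
  let b' := ev f (transvection k e true) in
  a' * b' * a'^-1 * b'^-1 = f false * f true * (f false)^-1 * (f true)^-1.
Proof.
by case: k e => -[] a' b'; rewrite /a' /b' /transvection /= !ev_cons !ev_nil /ev_letter /=
  !mulg1 ?invgM ?invgK !mulgA ?mulgK ?mulgVK.
Qed.

Lemma wexp_transvection k e w z :
  wexp z (subst (transvection k e) w) =
  (wexp z w + (z == ~~ k)%:Z * (if e then - wexp k w else wexp k w))%R.
Proof.
have -> : (wexp z w + (z == ~~ k)%:Z * (if e then - wexp k w else wexp k w))%R =
   (1 * wexp z w + ((z == ~~ k)%:Z * (if e then -1 else 1)) * wexp k w)%R.
  by case: (e); ring.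
rewrite -ev_intg_linear /wexp ev_subst; apply: ev_eq_in => c _.
by case: k e z c => -[] [] []; rewrite /transvection /= !ev_cons !ev_nil.
Qed.

Lemma euclid_step (p q : int) : `|p|%N <= `|q|%N -> p <> 0%R -> q <> 0%R ->
  `|(q + (if ~~ ((p < 0) != (q < 0)) then - p else p))%R|%N < `|q|%N.
Proof. by case: ifP; lia. Qed.

(** The Euclidean algorithm on the two exponent sums of w, carried out by changes of
    basis, ends when one of the sums is zero. *)
Lemma root_of_commutator_pair (F : groupType) (a b : F) (w : word bool) :
  free_pair a b -> is_root (ev (pair_fun a b) w) (a * b * a^-1 * b^-1) ->
  root_conclusion (ev (pair_fun a b) w) (a * b * a^-1 * b^-1).
Proof.
have [n] := ubnP (`|wexp false w|%N + `|wexp true w|%N).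
elim: n a b w => // n IH a b w wn ab Rw.
have [q0|q0] := eqVneq (wexp true w) 1; first exact: root_of_commutator_balanced.
have [p0|p0] := eqVneq (wexp false w) 1.
  have swapE : ev (pair_fun a b) w = ev (pair_fun b a) (relabel negb w).
    by rewrite ev_relabel; apply: ev_eq_in => -[].
  have [||pR|[cR|cR]] := @root_of_commutator_balanced F b a (relabel negb w)
    (free_pair_swap ab) _ _.
  - rewrite /wexp ev_relabel -p0; apply: ev_eq_in => -[] //.
  - by rewrite -swapE -commutatorV; apply: root_inv.
  - by left; rewrite swapE.
  - by right; right; rewrite swapE commutatorV.
  - by right; left; rewrite swapE -[_ * _ * _ * _]invgK commutatorV.
have [k le_k] : exists k, `|wexp k w|%N <= `|wexp (~~ k) w|%N.
  by case: (leqP `|wexp false w|%N `|wexp true w|%N) => [|/ltnW] ?;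
    [exists false|exists true].
have [pk pk'] : wexp k w <> 0%R /\ wexp (~~ k) w <> 0%R.
  by case: (k); split; apply/eqP.
pose e := ((wexp k w < 0)%R != (wexp (~~ k) w < 0)%R).
have := @free_pair_change _ a b (transvection k e) (transvection k (~~ e)) ab.
case=> [||ab' wE].
- exact: transvectionK.
- by move=> G f c; have := transvectionK k (~~ e) f c; rewrite negbK.
have comE := transvection_commutator k e (pair_fun a b).
rewrite wE -[a * b * _ * _]comE; apply: IH => //; last by rewrite -wE comE.
rewrite !wexp_transvection; move: le_k pk pk'; rewrite /e.
case: (k) => /= le_k pk pk'; have := euclid_step le_k pk pk';
  rewrite !GRing.mul1r !GRing.mul0r !GRing.addr0; move: wn;
  set A := absz (wexp false w); set B := absz (wexp true w);
  set C := absz (_ + _)%R; clearbody A B C; lia.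
Qed.

(** * Roots of the commutator *)

Unset Implicit Arguments.

Theorem mainTheorem3 (F : groupType) (a b : F) (hab : a <> b)
  (hF : free_basis [set a; b]) (R : F)
  (hR : is_root R (a * b * a^-1 * b^-1)) :
  primitive R \/
  (conjugate R (a * b * a^-1 * b^-1) \/
   conjugate R (a * b * a^-1 * b^-1)^-1).
Proof.
have ab := free_basis_pair hab hF; have [w Rw] := ab.1 R.
by rewrite Rw in hR *; apply: root_of_commutator_pair.
Qed.
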